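(* Let $m\in\mathbb{N}_0$, $n\geq 0$ an integer, and $x\in\mathbb{C}$. Then $$P_{n,M}(x;m)=\sum_{\substack{r_0,r_1,\ldots,r_m\geq 0\\ r_0+r_1+\cdots+r_m=n}}\frac{M_n!}{M_{r_0}!M_{r_1}!\cdots M_{r_m}!}\,x^{r_0},$$ the sum being over tuples of nonnegative integers. Equivalently, if the M-multinomial coefficient is defined, for nonnegative integers with $r_0+r_1+\cdots+r_m=n$, by $$\binom{n}{r_0,r_1,\ldots,r_m}_M=\frac{M_n!}{M_{r_0}!M_{r_1}!\cdots M_{r_m}!},$$ then $$P_{n,M}(x;m)=\sum_{\substack{r_0,r_1,\ldots,r_m\geq 0\\ r_0+r_1+\cdots+r_m=n}}\binom{n}{r_0,r_1,\ldots,r_m}_M x^{r_0}.$$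
   Context: $\mathbb{N}_0=\{0,1,2,\ldots\}$. For $n\ge 0$, $M_n=2^n-1$. The M-factorial is $M_0!=1$ and $M_n!=M_nM_{n-1}\cdots M_1$ for $n\geq 1$. The M-exponential is $e_M^{xt}=\sum_{n=0}^{\infty}\frac{x^nt^n}{M_n!}$, and $e_M^t$ denotes the case $x=1$. For $m\in\mathbb{N}_0$ the Mersenne translation polynomials $P_{n,M}(x;m)$ are defined by $e_M^{xt}\left(e_M^t\right)^m=\sum_{n=0}^{\infty}P_{n,M}(x;m)\frac{t^n}{M_n!}$, i.e. $P_{n,M}(x;m)=M_n!\,[t^n]\left(e_M^{xt}(e_M^t)^m\right)$, where $(e_M^t)^m$ is the ordinary $m$-fold product of power series in $t$ and $[t^n]$ denotes the coefficient of $t^n$. *)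

(* Defs.v *)
From mathcomp Require Import all_boot all_order all_algebra.
From mathcomp Require Import reals.
From mathcomp Require Import complex.

Set Implicit Arguments.
Unset Strict Implicit.
Unset Printing Implicit Defensive.

Import GRing.Theory.

Local Open Scope ring_scope.

(* A formal power series in t over F is its coefficient sequence: [f n] is the
   coefficient [t^n] f. *)
Definition fps (F : fieldType) : Type := nat -> F.

Definition fps_one (F : fieldType) : fps F := fun n => (n == 0%N)%:R.

Definition fps_mul (F : fieldType) (f g : fps F) : fps F :=
  fun n => \sum_(i < n.+1) f i * g (n - i)%N.

Definition fps_pow (F : fieldType) (f : fps F) (m : nat) : fps F :=
  iter m (fps_mul f) (fps_one F).

Definition mersenne (n : nat) : nat := (2 ^ n - 1)%N.

Definition mfact (n : nat) : nat := (\prod_(1 <= k < n.+1) mersenne k)%N.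

(* The M-exponential e_M^{xt}, as a formal power series in t. *)
Definition mexp (F : fieldType) (x : F) : fps F :=
  fun n => x ^+ n / (mfact n)%:R.

(* P_{n,M}(x;m) = M_n! [t^n] (e_M^{xt} (e_M^t)^m) *)
Definition mtrans (F : fieldType) (m n : nat) (x : F) : F :=
  (mfact n)%:R * fps_mul (mexp x) (fps_pow (mexp 1) m) n.

(* Valued in F, so the quotient is the exact one, not Euclidean division. *)
Definition mmultinomial (F : fieldType) (m n : nat) (r : 'I_m.+1 -> nat) : F :=
  (mfact n)%:R / \prod_(i < m.+1) (mfact (r i))%:R.

(* The tuples (r_0, ..., r_m) of nonnegative integers with sum n.  Each entry
   of such a tuple is at most n, so taking the entries in 'I_n.+1 loses none. *)
Definition compositions (m n : nat) : {set {ffun 'I_m.+1 -> 'I_n.+1}} :=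
  [set r : {ffun 'I_m.+1 -> 'I_n.+1} | (\sum_(i < m.+1) r i)%N == n].

(* Main.v *)
Require Import Defs.
From mathcomp Require Import all_boot all_order all_algebra.
From mathcomp Require Import reals.
From mathcomp Require Import complex.

(** Both sides are the coefficient of [t^n] in a product of [m.+1] power series,
    namely [e_M^{xt}] and [m] copies of [e_M^t], scaled by [M_n!].  That
    coefficient depends only on the coefficients of degree at most [n] of each
    factor, so the series may be replaced by their truncations, which are
    polynomials ([coef_trunc_mul], [coef_trunc_exp]).  Expanding a product of
    [m.+1] sums of monomials by distributivity yields one monomial per tuple
    [(r_0, ..., r_m)], of degree [r_0 + ... + r_m]; the coefficient of [t^n]
    retains exactly the tuples of sum [n] ([coef_prod_trunc]).  The factors
    [e_M^t] contribute only inverse M-factorials, and [e_M^{xt}] contributes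
    the power [x^{r_0}] ([mtrans_compositions]). *)

Set Implicit Arguments.
Unset Strict Implicit.
Unset Printing Implicit Defensive.

Import GRing.Theory.

Local Open Scope ring_scope.
Local Open Scope complex_scope.

Definition trunc (F : fieldType) (n : nat) (f : fps F) : {poly F} :=
  \poly_(i < n.+1) f i.

(** The coefficient of degree [k] of a Cauchy product involves only degrees at
    most [k] in each factor.  The right factor is any polynomial that agrees
    with [g] up to degree [n], not only the truncation of [g], because a product
    of truncations has spurious terms of degree above [n]: this form can be
    iterated over powers. *)
Lemma coef_trunc_mul (F : fieldType) (n : nat) (f g : fps F) (p : {poly F}) :
    (forall k, (k <= n)%N -> p`_k = g k) ->
  forall k, (k <= n)%N -> (trunc n f * p)`_k = fps_mul f g k.
Proof.
move=> p_g k le_kn; rewrite coefM; apply: eq_bigr => i _.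
have le_in : (i <= n)%N by apply: leq_trans le_kn; rewrite -ltnS.
by rewrite coef_poly ltnS le_in p_g // (leq_trans (leq_subr _ _)).
Qed.

Lemma coef_trunc_exp (F : fieldType) (n : nat) (f : fps F) (m k : nat) :
  (k <= n)%N -> (trunc n f ^+ m)`_k = fps_pow f m k.
Proof.
elim: m k => [|m IHm] k le_kn; first by rewrite expr0 coef1.
by rewrite exprS (coef_trunc_mul f IHm le_kn).
Qed.

(** Distributivity turns a product of sums of monomials into a sum over choice
    functions [r], the monomial chosen by [r] having degree [\sum_i r i]. *)
Lemma coef_prod_trunc (F : fieldType) (m n k : nat) (f : 'I_m -> fps F) :
  (\prod_(i < m) trunc n (f i))`_k =
    \sum_(r : {ffun 'I_m -> 'I_n.+1} | (\sum_(i < m) r i)%N == k)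
      \prod_(i < m) f i (r i).
Proof.
under eq_bigr do rewrite /trunc poly_def.
rewrite bigA_distr_bigA coef_sum [RHS]big_mkcond; apply: eq_bigr => r _.
rewrite scaler_prod prodrXr coefZ coefXn eq_sym.
by case: eqP => _; rewrite ?mulr1 ?mulr0.
Qed.

Lemma mtrans_compositions (F : fieldType) (m n : nat) (x : F) :
  mtrans m n x =
    \sum_(r in compositions m n) mmultinomial F n (fun i => r i) * x ^+ r ord0.
Proof.
pose f (i : 'I_m.+1) : fps F := mexp (if i == ord0 then x else 1).
have fS (i : 'I_m) : f (lift ord0 i) = mexp 1 by [].
have -> : mtrans m n x = (mfact n)%:R * (\prod_(i < m.+1) trunc n (f i))`_n.
  congr (_ * _); rewrite big_ord_recl.
  under eq_bigr do rewrite fS.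
  rewrite prodr_const card_ord.
  by rewrite (coef_trunc_mul _ (@coef_trunc_exp _ n (mexp 1) m)).
rewrite coef_prod_trunc mulr_sumr; apply: eq_big => [r|r _]; first by rewrite inE.
rewrite /mmultinomial -mulrA; congr (_ * _).
rewrite prodf_div mulrC; congr (_ * _).
rewrite big_ord_recl big1 ?mulr1 // => i _.
by rewrite expr1n.
Qed.

Theorem theorem3p2 (R : realType) (m n : nat) (x : R[i]) :
  mtrans m n x =
    \sum_(r in compositions m n)
      (mfact n)%:R / (\prod_(i < m.+1) (mfact (r i))%:R) * x ^+ r ord0
  /\
  mtrans m n x =
    \sum_(r in compositions m n)
      mmultinomial R[i] n (fun i => r i) * x ^+ r ord0.
Proof.
by split; apply: mtrans_compositions.
Qed.
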